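(* Let $G$ be a finite graph and $\mathcal L$ a non-trivial linear class of bonds of $G$. Then the bases of the join matroid $J(G,\mathcal L)$ are exactly the edge sets of forests $F$ of $G$ for which $\mathrm{Ext}(\pi_F)$ is a bond not belonging to $\mathcal L$.
   Context: Graphs are finite, loops and multiple edges allowed. A bond is a minimal nonempty edge cut; $\delta(X)$ is the set of links with exactly one endpoint in $X\subseteq V(G)$. A tribond is $\delta(X_1)\cup\delta(X_2)\cup\delta(X_3)$ for a partition $\{X_1,X_2,X_3\}$ of the vertex set of one connected component into nonempty sets with each $G[X_i]$ connected and an edge joining each pair. A linear class of bonds is a set $\mathcal L$ of bonds such that for each such tripartition the number of $i$ with $\delta(X_i)\in\mathcal L$ is never exactly two; it is trivial if it contains every bond. A modular pair of bonds $B_1,B_2$ is one for which $G-(B_1\cup B_2)$ has two more components than $G$; a dibond is the union of a modular pair that is not a tribond. For non-trivial $\mathcal L$, $J_0(G,\mathcal L)$ is the matroid on $E(G)\cup\{e_0\}$ whose cocircuits are the bonds in $\mathcal L$, the sets $B\cup\{e_0\}$ for bonds $B\notin\mathcal L$, and the tribonds and dibonds containing no bond of $\mathcal L$; and $J(G,\mathcal L)=J_0(G,\mathcal L)/e_0$. For $F\subseteq E(G)$, $\pi_F$ is the partition of $V(G)$ into vertex sets of the components of $(V(G),F)$, and $\mathrm{Ext}(\pi)$ is the set of edges of $G$ whose endpoints lie in different parts of $\pi$. *)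

(* Defs.v *)
From mathcomp Require Import all_boot.
From mathcomp Require Import zify.

Set Implicit Arguments.
Unset Strict Implicit.
Unset Printing Implicit Defensive.

(* Matroids whose ground set is the whole of a finite type *)

Record matroid (T : finType) := Matroid {
  indep : {set T} -> bool;
  indep0 : indep set0;
  indepS : forall A B : {set T}, A \subset B -> indep B -> indep A;
  indep_aug : forall A B : {set T}, indep A -> indep B -> #|A| < #|B| ->
    exists2 x, x \in B :\: A & indep (x |: A) }.

Definition basis (T : finType) (M : matroid T) (B : {set T}) : bool :=
  maxset (indep M) B.

Definition circuit (T : finType) (M : matroid T) (C : {set T}) : bool :=
  minset (fun A => ~~ indep M A) C.

Section Dual.
Variables (T : finType) (M : matroid T).
Implicit Types A B X Y I : {set T}.

Lemma basis_indep B : basis M B -> indep M B.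
Proof. exact: maxsetp. Qed.

Lemma card_indep_basis I B : indep M I -> basis M B -> #|I| <= #|B|.
Proof.
move=> indI /maxsetP[indB maxB]; rewrite leqNgt; apply/negP => ltBI.
have [x] := indep_aug indB indI ltBI; rewrite inE => /andP[xNB _] indxB.
by rewrite -(maxB _ indxB (subsetUr _ _)) setU11 in xNB.
Qed.

Lemma basis_card B I : basis M B -> indep M I -> #|B| <= #|I| -> basis M I.
Proof.
move=> basB indI leBI; apply/maxsetP; split=> // X indX sIX.
apply/esym/eqP; rewrite eqEcard sIX.
exact: leq_trans (card_indep_basis indX basB) leBI.
Qed.

Lemma basis_extend B I X : basis M B -> indep M I -> B \subset X ->
  I \subset X -> exists B', [/\ basis M B', I \subset B' & B' \subset X].
Proof.
move=> basB indI sBX sIX.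
have: [pred A | indep M A && (A \subset X)] I by rewrite /= indI.
case/maxset_exists => B' /maxsetP[/andP[indB' sB'X] maxB'] sIB'.
exists B'; split=> //; apply: (basis_card basB indB').
rewrite leqNgt; apply/negP => ltB'B.
have [x] := indep_aug indB' (basis_indep basB) ltB'B.
rewrite inE => /andP[xNB' xB] indx.
have /= E: x |: B' = B'.
  apply: maxB'; last exact: subsetUr.
  by rewrite /= indx subUset sub1set (subsetP sBX) ?sB'X.
by rewrite -E setU11 in xNB'.
Qed.

Definition dual_indep A : bool :=
  [exists B : {set T}, basis M B && [disjoint B & A]].

Lemma dual_indep0 : dual_indep set0.
Proof.
have [B basB _] := maxset_exists (indep0 M).
apply/existsP; exists B; by rewrite /basis basB -setI_eq0 setI0 /=.
Qed.

Lemma dual_indepS A B : A \subset B -> dual_indep B -> dual_indep A.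
Proof.
move=> sAB /existsP[C /andP[basC disC]]; apply/existsP; exists C.
by rewrite basC (disjointWr sAB disC).
Qed.

Lemma dual_indep_aug A B : dual_indep A -> dual_indep B -> #|A| < #|B| ->
  exists2 x, x \in B :\: A & dual_indep (x |: A).
Proof.
case/existsP=> BA /andP[basBA disA] /existsP[BB /andP[basBB disB]] ltAB.
have indI: indep M (BB :\: A).
  by apply: indepS (basis_indep basBB); apply: subsetDl.
have sBA: BA \subset ~: A by rewrite subsets_disjoint setCK.
have sI: BB :\: A \subset ~: A by rewrite setDE subsetIr.
have [B' [basB' sIB' sB'A]] := basis_extend basBA indI sBA sI.
have [sBAB'|] := boolP (B :\: A \subset B'); last first.
  case/subsetPn=> x xBA xNB'; exists x => //; apply/existsP; exists B'.
  rewrite basB' disjoints_subset setCU subsetI sB'A andbT.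
  by rewrite subsetC sub1set inE.
have: #|(BB :\: A) :|: (B :\: A)| <= #|BB|.
  apply: leq_trans (card_indep_basis (basis_indep basB') basBB).
  by apply: subset_leq_card; rewrite subUset sIB'.
have d0: BB :&: B = set0 by apply/eqP; rewrite setI_eq0.
have -> : #|(BB :\: A) :|: (B :\: A)| = #|BB :\: A| + #|B :\: A|.
  by rewrite cardsU -setDIl d0 set0D cards0 subn0.
have := cardsID A BB; have := cardsID A B.
have: #|BB :&: A| + #|B :&: A| <= #|A|.
  have <- : #|(BB :&: A) :|: (B :&: A)| = #|BB :&: A| + #|B :&: A|.
    by rewrite cardsU setIACA d0 set0I cards0 subn0.
  by rewrite -setIUl; apply: subset_leq_card; apply: subsetIr.
lia.
Qed.

Definition dual : matroid T := Matroid dual_indep0 dual_indepS dual_indep_aug.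

Definition cocircuit C : bool := circuit dual C.

End Dual.

(* Deletion and contraction of the point [None], leaving a matroid on [T]. *)

Section Minors.
Variables (T : finType) (M : matroid (option T)).

Definition delete_indep (A : {set T}) : bool := indep M (Some @: A).

Lemma delete_indep0 : delete_indep set0.
Proof. by rewrite /delete_indep imset0 indep0. Qed.

Lemma delete_indepS (A B : {set T}) :
  A \subset B -> delete_indep B -> delete_indep A.
Proof. by move=> sAB; apply: indepS; apply: imsetS. Qed.

Lemma delete_indep_aug (A B : {set T}) :
  delete_indep A -> delete_indep B -> #|A| < #|B| ->
  exists2 x, x \in B :\: A & delete_indep (x |: A).
Proof.
have injS : injective (@Some T) by move=> ? ? [].
move=> indA indB ltAB.
have [] := indep_aug indA indB; first by rewrite !card_imset.
move=> x; rewrite inE => /andP[xNA /imsetP[y yB Ex]] indx; exists y.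
  by rewrite inE yB andbT -(mem_imset _ _ injS) -Ex.
by rewrite /delete_indep imsetU1 -Ex.
Qed.

Definition delete_None : matroid T :=
  Matroid delete_indep0 delete_indepS delete_indep_aug.

End Minors.

Definition contract_None (T : finType) (M : matroid (option T)) : matroid T :=
  dual (delete_None (dual M)).

(* Finite multigraphs. The order of the two ends of an edge is only a device
   for recording them: every notion below is invariant under swapping. *)

Record mgraph := MGraph {
  vertex : finType;
  edge : finType;
  end1 : edge -> vertex;
  end2 : edge -> vertex }.

Arguments end1 {m} _.
Arguments end2 {m} _.

Section Graph.
Variable G : mgraph.
Local Notation V := (vertex G).
Local Notation E := (edge G).
Implicit Types (X Y : {set V}) (F B D : {set E}) (L : {set {set E}}).

Definition joins (e : E) : rel V := fun x y =>
  ((end1 e == x) && (end2 e == y)) || ((end1 e == y) && (end2 e == x)).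

Definition adj F : rel V := fun x y => [exists e in F, joins e x y].

(* Vertex sets of the components of the spanning subgraph (V, F); this is the
   partition pi_F. *)
Definition comps F : {set {set V}} :=
  equivalence_partition (connect (adj F)) setT.

Definition ext (P : {set {set V}}) : {set E} :=
  [set e | pblock P (end1 e) != pblock P (end2 e)].

Definition delta X : {set E} := [set e | (end1 e \in X) != (end2 e \in X)].

Definition edge_cut D : bool := [exists X : {set V}, D == delta X].

Definition bond D : bool := minset (fun C => (C != set0) && edge_cut C) D.

(* Connectedness of the induced subgraph G[X]. *)
Definition connected_in X : Prop :=
  {in X &, forall x y,
    connect (adj [set e | (end1 e \in X) && (end2 e \in X)]) x y}.

Definition edge_between X Y : Prop :=
  exists e : E, exists x y, [/\ x \in X, y \in Y & joins e x y].

Definition tripartition X1 X2 X3 : Prop :=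
  [/\ X1 :|: X2 :|: X3 \in comps setT,
      [/\ [disjoint X1 & X2], [disjoint X1 & X3] & [disjoint X2 & X3]],
      [/\ X1 != set0, X2 != set0 & X3 != set0],
      [/\ connected_in X1, connected_in X2 & connected_in X3] &
      [/\ edge_between X1 X2, edge_between X1 X3 & edge_between X2 X3]].

Definition tribond D : Prop :=
  exists X1 X2 X3,
    tripartition X1 X2 X3 /\ D = delta X1 :|: delta X2 :|: delta X3.

Definition linear_class L : Prop :=
  (forall B, B \in L -> bond B) /\
  (forall X1 X2 X3, tripartition X1 X2 X3 ->
     (delta X1 \in L) + (delta X2 \in L) + (delta X3 \in L) <> 2).

Definition trivial_class L : Prop := forall B, bond B -> B \in L.

Definition modular_pair B1 B2 : Prop :=
  [/\ bond B1, bond B2 & #|comps (~: (B1 :|: B2))| = #|comps setT| + 2].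

Definition dibond D : Prop :=
  (exists B1 B2, modular_pair B1 B2 /\ D = B1 :|: B2) /\ ~ tribond D.

(* The extra element e_0 is [None]. *)
Definition J0_cocircuit L (C : {set option E}) : Prop :=
  [\/ exists2 B, B \in L & C = Some @: B,
      exists B, [/\ bond B, B \notin L & C = None |: Some @: B] |
      exists D, [/\ tribond D \/ dibond D,
                    forall B, B \in L -> ~~ (B \subset D) & C = Some @: D]].

(* A matroid is determined by its cocircuits, so this singles out J_0(G, L). *)
Definition is_J0 L (M : matroid (option E)) : Prop :=
  forall C, cocircuit M C <-> J0_cocircuit L C.

(* A cycle visits n >= 1 distinct vertices along n distinct edges; n = 1 is a
   loop and n = 2 a pair of parallel edges. *)
Definition has_cycle F : Prop :=
  exists n (v : 'I_n -> V) (c : 'I_n -> E),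
    [/\ 0 < n, injective v, injective c &
        forall i, c i \in F /\ joins (c i) (v i) (v (ordS i))].

Definition forest F : Prop := ~ has_cycle F.

End Graph.

(* Main.v *)
Require Import Defs.
From mathcomp Require Import all_boot.
From mathcomp Require Import zify.

(* Bases of J(G, L) are the complements of the maximal edge sets D containing no
   bond of L, no tribond and no dibond.  Write c(F) for the number of components
   of (V, F).  If c(F) >= c(G) + 2, the complement of F contains a modular pair
   of bonds, so it is not such a D; and Ext(pi_F) is a bond iff
   c(F) = c(G) + 1, in which case it is the only bond avoiding F.  Hence forests
   with Ext(pi_F) a bond outside L give bases.  Non-triviality of L provides at
   least one such basis, of size |V| - c(G) - 1; since all bases are
   equicardinal and |V| <= |F| + c(F), every basis has c(F) = c(G) + 1 and is a
   forest. *)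

Set Implicit Arguments.
Unset Strict Implicit.
Unset Printing Implicit Defensive.

(** * Bases, duality and circuits of matroids *)

Section Matroids.
Variables (T : finType) (M : matroid T).
Implicit Types A B : {set T}.

(** A set is independent in the dual when it lies in the complement of some basis of [M]. No basis
    properly contains another, so the maximal such sets are exactly these complements. *)
Lemma basis_dual B : basis (dual M) B = basis M (~: B).
Proof.
apply/idP/idP => [/maxsetP[/existsP[C /andP[basC disC]] maxB]|basB].
  have sCB : C \subset ~: B by rewrite -disjoints_subset.
  suff <- : C = ~: B by [].
  rewrite -[LHS]setCK (maxB (~: C)) //; last by rewrite subsetC.
  by apply/existsP; exists C; rewrite basC disjoints_subset setCK subxx.
apply/maxsetP; split=> [|X /existsP[C /andP[basC disC]] sBX].
  by apply/existsP; exists (~: B); rewrite basB disjoints_subset subxx.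
have sCX : C \subset ~: X by rewrite -disjoints_subset.
have E : ~: B = C.
  have /maxsetP[_ maxC] := basC.
  apply: (maxC _ (basis_indep basB)).
  by apply: (subset_trans sCX); rewrite setCS.
apply/eqP; rewrite eqEsubset sBX andbT -[B]setCK E.
by rewrite subsetC.
Qed.

Lemma basis_eq_card A B : basis M A -> basis M B -> #|A| = #|B|.
Proof.
move=> bA bB; apply/eqP; rewrite eqn_leq.
by rewrite (card_indep_basis (basis_indep bA) bB)
  (card_indep_basis (basis_indep bB) bA).
Qed.

Lemma basisP B :
  reflect (indep M B /\ forall x, x \notin B -> ~~ indep M (x |: B))
          (basis M B).
Proof.
apply: (iffP maxsetP) => [[indB maxB]|[indB maxB]]; split=> //.
  move=> x; apply: contra => indxB.
  by rewrite -(maxB _ indxB (subsetUr _ _)) setU11.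
move=> X indX sBX; apply/eqP; rewrite eqEsubset sBX andbT.
apply/subsetP=> x xX; apply: contraT => /maxB/negP[].
by apply: indepS indX; rewrite subUset sub1set xX.
Qed.

Lemma indep_circuit A :
  reflect (forall C, circuit M C -> ~~ (C \subset A)) (indep M A).
Proof.
apply: (iffP idP) => [indA C /minsetp nC|noC].
  by apply: contra nC => sCA; apply: indepS indA.
apply: contraT => nA.
have [C mC sCA] := minset_exists (P := fun A => ~~ indep M A) nA.
by case/negP: (noC C mC).
Qed.

End Matroids.

Lemma disjointsU1 (T : finType) (x : T) (A B : {set T}) :
  [disjoint x |: A & B] = (x \notin B) && [disjoint A & B].
Proof. by rewrite !disjoints_subset subUset sub1set inE. Qed.

(** * Connectivity in spanning subgraphs *)

Section Graph.
Variable G : mgraph.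
Local Notation V := (vertex G).
Local Notation E := (edge G).
Implicit Types (X Y : {set V}) (F B D : {set E}) (e f : E) (x y : V).

Local Notation conn F := (connect (adj F)).
Local Notation ends_conn F e := (conn F (end1 e) (end2 e)).
Local Notation c F := #|comps F|.

Lemma joinsC e x y : joins e x y = joins e y x.
Proof. by rewrite /joins orbC. Qed.

Lemma joins_ends e : joins e (end1 e) (end2 e).
Proof. by rewrite /joins !eqxx. Qed.

Lemma conn_sym F : connect_sym (adj F).
Proof.
by apply: sym_connect_sym => x y; apply: eq_existsb => e; rewrite joinsC.
Qed.

Lemma conn_joins F e x y : e \in F -> joins e x y -> conn F x y.
Proof. by move=> eF jxy; apply/connect1/existsP; exists e; rewrite eF. Qed.

(** An edge of [F] outside [delta X] has both ends in [X] or neither, so [X] is closed under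
    [adj F]. This is the tool for proving that vertices are not connected. *)
Lemma cut_conn F X x y : [disjoint F & delta X] -> conn F x y ->
  (x \in X) = (y \in X).
Proof.
move=> dFX; move: x y; apply: closed_connect.
apply: intro_closed; first exact: conn_sym.
move=> x y /existsP[e /andP[eF jxy]] xX.
have := disjointFr dFX eF; rewrite inE => /negbFE/eqP Ee.
by move: jxy xX => /orP[]/andP[/eqP<- /eqP<-]; rewrite Ee.
Qed.

Definition component F x : {set V} := [set y | conn F x y].

Lemma component_cut F x : [disjoint F & delta (component F x)].
Proof.
apply/pred0P => e; rewrite /= !inE; apply/negP => /andP[eF /negP[]].
rewrite ![conn F x _]conn_sym; apply/eqP/same_connect; first exact: conn_sym.
exact: conn_joins eF (joins_ends e).
Qed.

(** The cut of an [F']-component avoids [F], because [F'] connects the ends of every edge of [F];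
    [cut_conn] then applies to that component. *)
Lemma conn_trans_edges F F' : {in F, forall e, ends_conn F' e} ->
  forall x y, conn F x y -> conn F' x y.
Proof.
move=> FF' x y Fxy.
suff: y \in component F' x by rewrite inE.
rewrite -(cut_conn _ Fxy) ?inE //.
apply/pred0P => e; rewrite /= !inE; apply/negP => /andP[/FF' Fe /negP[]].
rewrite ![conn F' x _]conn_sym; apply/eqP/same_connect => //.
exact: conn_sym.
Qed.

Lemma connS F F' x y : F \subset F' -> conn F x y -> conn F' x y.
Proof.
move=> /subsetP sFF'; apply: conn_trans_edges => e /sFF' eF'.
exact: conn_joins eF' (joins_ends e).
Qed.

Lemma conn_equiv F : {in [set: V] & &, equivalence_rel (conn F)}.
Proof.
move=> x y z _ _ _; split=> // xy.
exact: (same_connect (@conn_sym F) xy).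
Qed.

Lemma compsE F : comps F = component F @: [set: V].
Proof.
rewrite /comps /equivalence_partition; apply: eq_imset => x.
by apply/setP => y; rewrite !inE.
Qed.

Lemma extE F e : (e \in ext (comps F)) = ~~ ends_conn F e.
Proof.
have [_ tI _] := and3P (equivalence_partitionP (@conn_equiv F)).
have cov x : x \in cover (comps F).
  by rewrite (cover_partition (equivalence_partitionP (@conn_equiv F))).
rewrite inE eq_pblock ?cov // pblock_equivalence_partition ?inE //.
exact: conn_equiv.
Qed.

Lemma ext_sub F : ext (comps F) \subset ~: F.
Proof.
apply/subsetP => e; rewrite extE inE; apply: contra => eF.
exact: conn_joins eF (joins_ends e).
Qed.

Lemma eq_comps F F' : (forall x y, conn F x y = conn F' x y) ->
  comps F = comps F'.
Proof.
move=> FF'; rewrite !compsE; apply: eq_imset => x.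
by apply/setP => y; rewrite !inE FF'.
Qed.

Lemma component_refl F x : x \in component F x.
Proof. by rewrite inE connect0. Qed.

Lemma component_eq F x y : conn F x y -> component F x = component F y.
Proof.
move=> Fxy; apply/setP => z; rewrite !inE.
exact: (same_connect (@conn_sym F)).
Qed.

(** * How the number of components changes as edges are added *)

Lemma comps_addN F e : ends_conn F e -> comps (e |: F) = comps F.
Proof.
move=> Fe; apply: eq_comps => x y; apply/idP/idP; last exact/connS/subsetUr.
apply: conn_trans_edges => f; rewrite !inE => /orP[/eqP->//|fF].
exact: conn_joins fF (joins_ends f).
Qed.

(** The new edge fuses the components of its two ends into their union [U] and leaves every other
    component unchanged. *)
Lemma card_comps_add F e : ~~ ends_conn F e -> c F = (c (e |: F)).+1.
Proof.
move=> nFe; set a := end1 e in nFe; set b := end2 e in nFe.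
set F' := e |: F.
pose U := component F a :|: component F b.
have F'ab : conn F' a b by apply: (conn_joins (setU11 _ _)); apply: joins_ends.
have sFF' : F \subset F' by apply: subsetUr.
have UE : component F' a = U.
  apply/eqP; rewrite eqEsubset; apply/andP; split; last first.
    apply/subsetP=> x; rewrite !inE => /orP[|] /(connS sFF') //.
    exact: connect_trans.
  apply/subsetP=> x; rewrite inE => F'ax.
  rewrite -(cut_conn _ F'ax) ?inE ?connect0 //.
  apply/pred0P => f; rewrite /= !inE; apply/negP.
  case/andP=> /orP[/eqP->|fF]; first by rewrite !connect0 orbT.
  have := conn_joins fF (joins_ends f) => Ff.
  rewrite !(conn_sym F a) !(conn_sym F b).
  by rewrite !(same_connect (@conn_sym F) Ff) eqxx.
have nU x : x \notin U -> component F' x = component F x.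
  rewrite !inE negb_or (conn_sym F a) (conn_sym F b) => /andP[xa xb].
  apply/setP=> y; apply/idP/idP; rewrite [_ \in component F' x]inE; last first.
    by rewrite inE; apply: connS.
  move/cut_conn => <-; first by rewrite inE connect0.
  apply/pred0P => f; rewrite /= 2!inE; apply/negP.
  case/andP=> /orP[/eqP->|fF]; first by rewrite !inE (negPf xa) (negPf xb).
  by rewrite (disjointFr (component_cut F x) fF).
have cF : comps F = component F a |: (component F b |: component F @: ~: U).
  rewrite compsE; apply/setP => Z; rewrite !inE; apply/imsetP/idP.
    case=> x _ ->; have [|xU] := boolP (x \in U); last first.
      by rewrite imset_f ?orbT // in_setC.
    by rewrite !inE => /orP[]/component_eq->; rewrite eqxx ?orbT.
  by case/or3P => [/eqP->|/eqP->|/imsetP[x _ ->]]; eexists; rewrite ?inE.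
have cF' : comps F' = U |: component F @: ~: U.
  rewrite compsE; apply/setP => Z; rewrite !inE; apply/imsetP/idP.
    case=> x _ ->; have [xU|xU] := boolP (x \in U); last first.
      by rewrite (nU x xU) imset_f ?orbT // in_setC.
    by move: xU; rewrite -UE inE => /component_eq->; rewrite eqxx.
  case/orP=> [/eqP->|/imsetP[x xU ->]]; first by exists a; rewrite ?inE.
  by exists x; rewrite ?inE // nU // -in_setC.
(* It remains to see that the listed members are distinct: components of vertices outside [U] do not
   meet [U], and the components of [a] and [b] differ. *)
rewrite cF cF' !cardsU1 !inE.
have notin z : z \in U -> component F z \notin component F @: ~: U.
  move=> zU; apply/imsetP => -[x]; rewrite inE => xU Ez.
  have : z \in component F x by rewrite -Ez component_refl.
  rewrite inE conn_sym => Fzx; case/negP: xU; move: zU; rewrite !inE.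
  by case/orP => /connect_trans/(_ Fzx)->; rewrite ?orbT.
have aU : a \in U by rewrite inE component_refl.
have bU : b \in U by rewrite !inE connect0 orbT.
have nab : component F a != component F b.
  by apply: contraNneq nFe => Eab; have := component_refl F b; rewrite -Eab inE.
have UN : U \notin component F @: ~: U.
  apply/imsetP => -[x]; rewrite inE => xU Ux; case/negP: xU.
  by rewrite Ux component_refl.
by rewrite (negPf (notin _ aU)) (negPf (notin _ bU)) UN (negPf nab).
Qed.

(** If [F] already connects the ends of every edge of [F'], the components agree. Otherwise adding
    an edge of [F'] that joins two components lowers the count, and induction on the number of
    missing edges finishes. *)
Lemma comps_sub F F' : F \subset F' -> comps F = comps F' \/ c F' < c F.
Proof.
have [n] := ubnP #|F' :\: F|; elim: n F => // n IHn F ltn sFF'.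
have [/forall_inP connF|] := boolP [forall e in F', ends_conn F e].
  left; apply: eq_comps => x y; apply/idP/idP; first exact: connS.
  exact: conn_trans_edges.
rewrite negb_forall_in => /exists_inP[e eF' nFe]; right.
have eNF : e \notin F.
  by apply: contra nFe => /conn_joins; apply; apply: joins_ends.
have [||<-|] := IHn (e |: F).
- have : #|F' :\: (e |: F)| < #|F' :\: F|.
    apply: proper_card; apply/properP; split; first exact/setDS/subsetUr.
    by exists e; rewrite !inE ?eqxx // eNF.
  lia.
- by rewrite subUset sub1set eF'.
- by rewrite (card_comps_add nFe).
- by rewrite (card_comps_add nFe) ltnS; apply: ltnW.
Qed.

Lemma card_compsS F F' : F \subset F' -> c F' <= c F.
Proof. by case/comps_sub => [->//|/ltnW]. Qed.

Lemma eq_comps_card F F' : F \subset F' -> c F <= c F' -> comps F = comps F'.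
Proof. by case/comps_sub => // lt; rewrite leqNgt lt. Qed.

Lemma eq_comps_ends F F' e : comps F = comps F' ->
  ends_conn F e = ends_conn F' e.
Proof. by move=> EF; apply/negb_inj; rewrite -!extE EF. Qed.

Lemma ext_neq0 F : c [set: E] < c F -> exists e, ~~ ends_conn F e.
Proof.
move=> lt; apply/existsP; apply: contraLR lt => /existsPn connF.
rewrite -leqNgt; suff -> : comps F = comps setT by [].
apply: eq_comps => x y; apply/idP/idP; first exact/connS/subsetT.
by apply: conn_trans_edges => e _; apply/negPn.
Qed.

(** A discrete intermediate value argument: while the count exceeds that of [G], some edge joins two
    components, and adding it lowers the count by exactly one. *)
Lemma comps_between F k : c [set: E] <= k -> k <= c F ->
  exists2 F' : {set E}, F \subset F' & c F' = k.
Proof.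
move=> Gk; have [n] := ubnP (c F); elim: n F => // n IHn F ltn kF.
have [ltk|lek] := ltnP k (c F); last by exists F => //; lia.
have [e nFe] := ext_neq0 (leq_ltn_trans Gk ltk).
have cF := card_comps_add nFe.
have [||F' sF'] := IHn (e |: F); try lia.
by exists F' => //; apply: subset_trans sF'; apply: subsetUr.
Qed.

(** * Vertices counted by edges and components *)

Lemma card_comps0 : c (@set0 E) = #|V|.
Proof.
rewrite compsE card_in_imset ?cardsT // => x y _ _ Exy.
have := component_refl set0 y; rewrite -Exy inE => /connectP[[|z p] /=].
  by move=> _ ->.
by case/andP=> /existsP[e]; rewrite inE.
Qed.

(** Deleting an edge raises the number of components by at most one, and the edgeless graph has
    [#|V|] of them. *)
Lemma card_vertices_le F : #|V| <= #|F| + c F.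
Proof.
have [n] := ubnP #|F|; elim: n F => // n IHn F ltn.
have [->|[e eF]] := set_0Vmem F; first by rewrite cards0 card_comps0.
have := cardsD1 e F; rewrite eF => cardF.
have /IHn : #|F :\ e| < n by lia.
have [Fe|Fe] := boolP (ends_conn (F :\ e) e).
  by rewrite -(comps_addN Fe) setD1K //; lia.
by rewrite (card_comps_add Fe) setD1K //; lia.
Qed.

Lemma card_vertices_bridges F : {in F, forall e, ~~ ends_conn (F :\ e) e} ->
  #|V| = #|F| + c F.
Proof.
have [n] := ubnP #|F|; elim: n F => // n IHn F ltn bridgeF.
have [->|[e eF]] := set_0Vmem F; first by rewrite cards0 card_comps0.
have := cardsD1 e F; rewrite eF => cardF.
have -> : #|V| = #|F :\ e| + c (F :\ e).
  apply: IHn; first lia.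
  move=> f; rewrite inE => /andP[_ fF]; apply: contra (bridgeF f fF).
  by apply: connS; apply/setSD/subsetDl.
by rewrite (card_comps_add (bridgeF e eF)) setD1K //; lia.
Qed.

(** * Bonds and sets with one component more than [G] *)

Lemma cut_ext F X : [disjoint F & delta X] -> delta X \subset ext (comps F).
Proof.
move=> dFX; apply/subsetP=> e; rewrite extE inE; apply: contra.
by move/(cut_conn dFX)->.
Qed.

Lemma bond_comps B : bond B ->
  c (~: B) = (c [set: E]).+1 /\ ext (comps (~: B)) = B.
Proof.
case/minsetP => /andP[/set0Pn[e eB] /existsP[X /eqP EB]] minB.
have dX : [disjoint ~: B & delta X].
  by rewrite disjoints_subset EB subxx.
have extB : ext (comps (~: B)) = B.
  apply/eqP; rewrite eqEsubset {3}EB cut_ext // andbT.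
  by rewrite -{2}[B]setCK ext_sub.
split=> //.
have nBe : ~~ ends_conn (~: B) e by rewrite -extE extB.
(* Putting back the edge [e] of [B] must restore the components of [G]. Otherwise some [f] still
   joins two components, and the cut of one of them is nonempty, lies in [B] and misses [e], against
   minimality. *)
rewrite (card_comps_add nBe); congr _.+1; apply/eqP.
rewrite eqn_leq (card_compsS (subsetT _)) andbT leqNgt; apply/negP.
case/ext_neq0 => f nf; pose F := e |: ~: B; pose Y := component F (end1 f).
have dY : [disjoint F & delta Y] by apply: component_cut.
have sYB : delta Y \subset B.
  apply/subsetP => g gY; have := disjointFl dY gY.
  by rewrite !inE => /norP[_]; rewrite negbK.
have YB : delta Y = B.
  apply: minB => //; apply/andP; split; last by apply/existsP; exists Y.
  by apply/set0Pn; exists f; rewrite !inE connect0 (negPf nf).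
by have := disjointFr dY (setU11 _ _); rewrite YB eB.
Qed.

Lemma bond_ext F : c F = (c [set: E]).+1 -> bond (ext (comps F)).
Proof.
move=> cF.
(* One edge of the cut added to [F] already gives the components of [G], so no nonempty cut avoids
   the enlarged set. *)
have spanF f X : f \in ext (comps F) -> [disjoint f |: F & delta X] ->
    delta X = set0.
  rewrite extE => nFf dX; have := card_comps_add nFf; rewrite cF => -[cfF].
  apply/eqP; rewrite -subset0; apply: subset_trans (cut_ext dX) _.
  rewrite (@eq_comps_card _ setT) ?subsetT -?cfF //.
  by apply: subset_trans (ext_sub _) _; rewrite setCT.
have [e nFe] : exists e, ~~ ends_conn F e by apply: ext_neq0; rewrite cF.
pose X := component F (end1 e).
have dX : [disjoint F & delta X] by apply: component_cut.
have eX : e \in delta X by rewrite !inE connect0 (negPf nFe).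
(* Hence a nonempty cut avoiding [F] contains every edge of [ext (comps F)]. This shows both that
   the latter is a cut and that it is minimal. *)
have minF Y : [disjoint F & delta Y] -> delta Y != set0 ->
    delta Y = ext (comps F).
  move=> dY nY; apply/eqP; rewrite eqEsubset cut_ext //=.
  apply/subsetP=> f fF; apply: contraNT nY => fY; apply/eqP/(spanF f) => //.
  by rewrite disjointsU1 fY.
apply/minsetP; split=> [|C /andP[nC /existsP[Y /eqP EC]] sC].
  rewrite -(minF X) //; last by apply/set0Pn; exists e.
  apply/andP; split; first by apply/set0Pn; exists e.
  by apply/existsP; exists X.
rewrite EC; apply: minF; rewrite -?EC // disjoints_subset subsetC.
by rewrite (subset_trans sC (ext_sub _)).
Qed.

(** [F] and the complement of [ext (comps F)] have the same components, since the edges of that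
    complement join vertices already connected by [F]. *)
Lemma card_comps_bond F : bond (ext (comps F)) -> c F = (c [set: E]).+1.
Proof.
case/bond_comps => <- _.
suff {1}-> : comps F = comps (~: ext (comps F)) by [].
apply: eq_comps => x y; apply/idP/idP.
  by apply: connS; rewrite subsetC ext_sub.
by apply: conn_trans_edges => e; rewrite inE extE negbK.
Qed.

(** * Tribonds and modular pairs *)

Lemma delta_joins e X x y : joins e x y ->
  (e \in delta X) = ((x \in X) != (y \in X)).
Proof.
by rewrite inE => /orP[]/andP[/eqP-> /eqP->] //; rewrite eq_sym.
Qed.

Lemma ends_conn_joins F e x y : joins e x y -> ends_conn F e = conn F x y.
Proof. by case/orP=> /andP[/eqP-> /eqP->] //; rewrite conn_sym. Qed.

(** With [F] the complement of [D], an edge [e] between [X1] and [X2] joins two components of [F].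
    It does not lie in [delta X3], so an edge [f] between [X1] and [X3] still joins two components
    after [e] is added: the count drops twice. *)
Lemma tribond_comps D : tribond D -> c [set: E] + 2 <= c (~: D).
Proof.
case=> X1 [X2 [X3 [[_ [d12 d13 d23] _ _ [b12 b13 _]] ->]]].
set F := ~: _.
have dF X : delta X \subset ~: F -> [disjoint F & delta X].
  by move=> sX; rewrite disjoints_subset subsetC.
have dX1 : [disjoint F & delta X1] by apply: dF; rewrite setCK -setUA subsetUl.
have dX3 : [disjoint F & delta X3] by apply: dF; rewrite setCK subsetUr.
case: b12 => e [x1 [x2 [x1X x2X je]]]; case: b13 => f [y1 [y3 [y1X y3X jf]]].
have nFe : ~~ ends_conn F e.
  rewrite (ends_conn_joins _ je); apply/negP => /(cut_conn dX1).
  by rewrite x1X (disjointFl d12 x2X).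
have nFf : ~~ ends_conn (e |: F) f.
  have dX3' : [disjoint e |: F & delta X3].
    rewrite disjointsU1 dX3 andbT (delta_joins _ je).
    by rewrite (disjointFr d13 x1X) (disjointFr d23 x2X).
  rewrite (ends_conn_joins _ jf); apply/negP => /(cut_conn dX3').
  by rewrite y3X (disjointFr d13 y1X).
rewrite (card_comps_add nFe) (card_comps_add nFf).
by rewrite addn2 !ltnS card_compsS // subsetT.
Qed.

(** Enlarge [F] until exactly two extra components remain, then choose [e] and [f] that remove them
    one after the other. Adding only [e] or only [f] leaves one extra component, which gives the two
    bonds. *)
Lemma modular_pair_sub F : c [set: E] + 2 <= c F ->
  exists B1 B2, modular_pair B1 B2 /\ B1 :|: B2 \subset ~: F.
Proof.
move=> leF; have [F' sFF' cF'] := comps_between (leq_addr _ _) leF.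
have [e nFe] : exists e, ~~ ends_conn F' e by apply: ext_neq0; lia.
have cFe := card_comps_add nFe.
have [f nFf] : exists f, ~~ ends_conn (e |: F') f by apply: ext_neq0; lia.
have nF'f : ~~ ends_conn F' f by apply: contra nFf; apply/connS/subsetUr.
have cFf := card_comps_add nF'f.
pose B1 := ext (comps (e |: F')); pose B2 := ext (comps (f |: F')).
have bB1 : bond B1 by apply: bond_ext; lia.
have bB2 : bond B2 by apply: bond_ext; lia.
have sB a : ext (comps (a |: F')) \subset ~: F'.
  by apply: subset_trans (ext_sub _) _; rewrite setCS subsetUr.
have sBB : B1 :|: B2 \subset ~: F' by rewrite subUset; apply/andP; split; apply: sB.
exists B1, B2; split; last by apply: subset_trans sBB _; rewrite setCS.
(* The upper bound holds because [F'] avoids both bonds. For the lower bound, [f] lies in [B1] but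
   not in [B2], so adding it to the complement of the union lowers the count and stays inside
   [~: B2], which has one component more than [G]. *)
split=> //; apply/eqP; rewrite eqn_leq -{1}cF' card_compsS 1?subsetC //=.
have nf : ~~ ends_conn (~: (B1 :|: B2)) f.
  have [_ extB1] := bond_comps bB1.
  have : ~~ ends_conn (~: B1) f by rewrite -extE extB1 extE.
  by apply: contra; apply: connS; rewrite setCS subsetUl.
rewrite (card_comps_add nf) addn2 ltnS; have [<- _] := bond_comps bB2.
apply: card_compsS; rewrite subUset sub1set setCS subsetUr andbT inE.
by rewrite extE negbK; apply: conn_joins (setU11 _ _) (joins_ends f).
Qed.

(** * Cycles, bridges and forests *)

Lemma has_cycleP F :
  has_cycle F <-> exists2 e, e \in F & ends_conn (F :\ e) e.
Proof.
split=> [[[|n] [v [d [// _ injv injd cycle]]]]|[e eF]].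
  have [dF jd] := cycle ord_max; exists (d ord_max) => //.
  rewrite (ends_conn_joins _ jd) conn_sym.
  have -> : ordS (@ord_max n) = ord0 by apply: val_inj; rewrite /= modnn.
  (* Without its last edge the cycle is a path from [v ord0] to its last vertex, followed here one
     index at a time. *)
  suff path k : k <= n -> conn (F :\ d ord_max) (v ord0) (v (inord k)).
    by have := path n (leqnn n); rewrite (_ : inord n = ord_max) //;
      apply: val_inj; rewrite /= inordK.
  elim: k => [|k IHk] lekn.
    by rewrite (_ : inord 0 = ord0) ?connect0 //;
      apply: val_inj; rewrite /= inordK.
  apply: connect_trans (IHk (ltnW lekn)) _.
  have [dkF jk] := cycle (inord k).
  have -> : inord k.+1 = ordS (inord k : 'I_n.+1).
    by apply: val_inj; rewrite /= !inordK ?modn_small // ltnS // ltnW.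
  apply: conn_joins jk; rewrite !inE dkF andbT (inj_eq injd).
  by rewrite -val_eqE /= inordK; lia.
(* A repetition-free path from [end2 e] to [end1 e] avoiding [e] is closed up by [e]. If [e] is a
   loop, the path is empty and [n] is 0. *)
rewrite conn_sym => /connectP[p0 pathp0 lastp0].
case/shortenP: pathp0 lastp0 => p pathp uniqp _ {p0} lastp.
pose s := end2 e :: p; pose n := size p.
pose v (i : 'I_n.+1) := nth (end2 e) s i.
(* Index [n] carries the closing edge [e]. The default [e] is never taken at a smaller index, as
   [dP] shows. *)
pose d (i : 'I_n.+1) := if i == n :> nat then e else
  odflt e [pick f in F :\ e | joins f (v i) (v (ordS i))].
have vlast (i : 'I_n.+1) : i = n :> nat -> v i = end1 e /\ v (ordS i) = end2 e.
  by move=> En; rewrite /v /= En modnn lastp -last_nth.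
have dP (i : 'I_n.+1) : i < n ->
    d i \in F :\ e /\ joins (d i) (v i) (v (ordS i)).
  move=> ltin; rewrite /d ltn_eqF //; case: pickP => [f /andP[]//|noF].
  have /existsP[f] := pathP (end2 e) pathp i ltin.
  have := noF f; rewrite /= /v /= modn_small //= => ->.
  by [].
have jd i : joins (d i) (v i) (v (ordS i)).
  have [/dP[]//|] := ltnP i n; move=> lein.
  have En : i = n :> nat by apply/eqP; rewrite eqn_leq lein -ltnS ltn_ord.
  by have [-> ->] := vlast i En; rewrite /d En eqxx joins_ends.
have injv : injective v.
  move=> i j /eqP; rewrite /v nth_uniq ?ltn_ord // => /eqP; exact: val_inj.
exists n.+1, v, d; split=> // [i j Eij|i]; last first.
  split=> //; have [/dP[]|lein] := ltnP i n; first by rewrite inE => /andP[].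
  by rewrite /d ifT //; have := ltn_ord i; lia.
(* The closing edge differs from the others, which lie in [F :\ e]. If two indices below [n] shared
   an edge, then either they are equal or each is the successor of the other, which is impossible as
   neither successor wraps around. *)
apply: val_inj => /=; have := ltn_ord i; have := ltn_ord j.
rewrite ltnS leq_eqVlt => /orP[/eqP Ej|ltj];
  rewrite ltnS leq_eqVlt => /orP[/eqP Ei|lti]; first by rewrite Ei.
- have [+ _] := dP i lti; rewrite Eij /d Ej eqxx !inE eqxx.
  by [].
- have [+ _] := dP j ltj; rewrite -Eij /d Ei eqxx !inE eqxx.
  by [].
have := jd j; have := jd i; rewrite -Eij.
have ordSE (k : 'I_n.+1) : k < n -> ordS k = k.+1 :> nat.
  by move=> ltk; rewrite /= modn_small.
have := ordSE i lti; have := ordSE j ltj; rewrite /joins => Sj Si.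
case/orP=> /andP[/eqP-> /eqP->];
  case/orP=> /andP[/eqP/injv Eij1 /eqP/injv Eij2].
- by rewrite Eij1.
- by move: Sj Si; rewrite -Eij1 Eij2; lia.
- by move: Sj Si; rewrite -Eij2 Eij1; lia.
- by rewrite Eij2.
Qed.

Lemma forestP F : forest F <-> {in F, forall e, ~~ ends_conn (F :\ e) e}.
Proof.
split=> [forestF e eF|bridgeF /has_cycleP[e /bridgeF/negP]//].
by apply/negP => Fe; apply: forestF; apply/has_cycleP; exists e.
Qed.

Lemma card_forest F : forest F -> #|V| = #|F| + c F.
Proof. by move/forestP/card_vertices_bridges. Qed.

(** A minimal subset of [F] with the same components contains only bridges, since deleting a
    non-bridge would preserve the components. *)
Lemma spanning_forest F :
  exists F', [/\ F' \subset F, forest F' & comps F' = comps F].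
Proof.
pose P := fun A : {set E} => comps A == comps F.
have PF : P F by apply: eqxx.
have [F' /minsetP[/eqP EF' minF'] sF'F] := minset_exists PF.
exists F'; split=> //; apply/forestP => e eF'; apply/negP => Fe.
have := cardsD1 e F'; rewrite (minF' (F' :\ e)) ?subsetDl ?eF' //; first lia.
by rewrite /P -(comps_addN Fe) setD1K // EF'.
Qed.

(** * The join matroid through its dual *)

Variables (L : {set {set E}}) (J0 : matroid (option E)).
Hypotheses (bondL : forall B, B \in L -> bond B) (hJ0 : is_J0 L J0).

(** [contract_None J0] is by definition the dual of this matroid, so the bases of the join are the
    complements of its bases. *)
Local Notation Jdual := (delete_None (dual J0)).

(** Circuits of [dual J0] are cocircuits of [J0], and deleting [None] discards those through it.
    Tribonds and dibonds that contain a bond of [L] may be listed too, since that bond already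
    forbids them. *)
Lemma indep_Jdual D :
  indep Jdual D <->
  (forall B, B \in L -> ~~ (B \subset D)) /\
  (forall D', tribond D' \/ dibond D' -> ~~ (D' \subset D)).
Proof.
have sub_Some (A B : {set E}) : (Some @: A \subset Some @: B) = (A \subset B).
  apply/idP/idP => [/subsetP sAB|]; last exact: imsetS.
  apply/subsetP=> x xA; have /sAB := imset_f Some xA.
  by rewrite mem_imset // => ? ? [].
split=> [indJD|[nL nD]].
  have /indep_circuit indD : indep (dual J0) (Some @: D) := indJD.
  have nL B : B \in L -> ~~ (B \subset D).
    move=> BL; rewrite -sub_Some; apply/indD/hJ0.
    by apply: Or31; exists B.
  split=> // D' trdiD'; apply/negP => sD'D.
  have: ~~ (Some @: D' \subset Some @: D).
    apply/indD/hJ0/Or33; exists D'; split=> // B /nL.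
    by apply: contra => /subset_trans; apply.
  by rewrite sub_Some sD'D.
suff : indep (dual J0) (Some @: D) by [].
apply/indep_circuit => C /hJ0[[B BL ->]|[B [_ _ ->]]|[D' [trdiD' _ ->]]].
- by rewrite sub_Some nL.
- apply/negP => /subsetP/(_ None (setU11 _ _)).
  by case/imsetP.
- by rewrite sub_Some nD.
Qed.

Lemma indep_Jdual_comps F : indep Jdual (~: F) -> c F <= (c [set: E]).+1.
Proof.
case/indep_Jdual => _ nD; rewrite leqNgt; apply/negP => ltF.
have [|B1 [B2 [mB sB]]] := @modular_pair_sub F; first lia.
(* The union of the pair is a tribond or else a dibond, and both are forbidden inside [~: F]. *)
have ntri : ~ tribond (B1 :|: B2).
  by move=> tri; have := nD _ (or_introl tri); rewrite sB.
have di : dibond (B1 :|: B2) by split=> //; exists B1, B2.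
by have := nD _ (or_intror di); rewrite sB.
Qed.

Lemma indep_Jdual_bond F : bond (ext (comps F)) ->
  indep Jdual (~: F) <-> ext (comps F) \notin L.
Proof.
move=> bF; have cF := card_comps_bond bF.
split=> [/indep_Jdual[nL _]|extL].
  by apply/negP => /nL; rewrite ext_sub.
(* A bond avoiding [F] leaves as many components as [F] does, so it equals [ext (comps F)]. A
   tribond or dibond leaves at least one more than [F], so it cannot avoid [F]. *)
apply/indep_Jdual; split=> [B BL|D trdi]; apply/negP; rewrite subsetC => sF.
  have [cB extB] := bond_comps (bondL BL).
  by case/negP: extL; rewrite (eq_comps_card sF) ?extB // cB cF.
have := card_compsS sF; rewrite cF; suff : c [set: E] + 2 <= c (~: D) by lia.
case: trdi => [/tribond_comps//|[[B1 [B2 [[_ _ cB] ->]]] _]].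
by rewrite cB.
Qed.

(** Every edge of [F] is a bridge, so moving it to the complement leaves two components more than
    [G] has, which independence excludes. *)
Lemma basis_forest F : forest F -> bond (ext (comps F)) ->
  ext (comps F) \notin L -> basis Jdual (~: F).
Proof.
move=> /forestP bridgeF bF extL; apply/basisP; split.
  exact/indep_Jdual_bond.
move=> e; rewrite inE negbK => eF; have nFe := bridgeF e eF.
have -> : e |: ~: F = ~: (F :\ e) by rewrite setDE setCI setCK setUC.
apply/negP => /indep_Jdual_comps; rewrite (card_comps_add nFe) setD1K //.
by rewrite (card_comps_bond bF) ltnn.
Qed.

Hypothesis nontrivL : ~ trivial_class L.

(** A spanning forest of the complement of a bond outside [L]. It fixes the common size of all
    bases. *)
Lemma exists_basis_forest : exists F, [/\ forest F,
  c F = (c [set: E]).+1 & basis Jdual (~: F)].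
Proof.
have [B bB BL] : exists2 B, bond B & B \notin L.
  have [/exists_inP//|] := boolP [exists B in @bond G, B \notin L].
  rewrite negb_exists_in => /forall_inP allL; case: nontrivL => B bB.
  by apply/negPn/allL.
have [cB extB] := bond_comps bB.
have [F [_ forestF EF]] := spanning_forest (~: B).
by exists F; split; rewrite ?EF //; apply: basis_forest; rewrite // EF extB.
Qed.

Lemma basis_Jdual F : basis Jdual (~: F) ->
  [/\ forest F, bond (ext (comps F)) & ext (comps F) \notin L].
Proof.
move=> basF; have [F0 [forestF0 cF0 basF0]] := exists_basis_forest.
have indF := basis_indep basF; have leF := indep_Jdual_comps indF.
have cardF : #|F| = #|F0|.
  have := basis_eq_card basF basF0.
  by have := cardsC F; have := cardsC F0; lia.
have VF0 := card_forest forestF0; have leVF := card_vertices_le F.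
(* [F] has the size of [F0], so [leVF] and [VF0] force at least [c F0] components; [leF] gives the
   reverse inequality. *)
have bF : bond (ext (comps F)) by apply: bond_ext; lia.
split=> //; last exact/indep_Jdual_bond.
apply/forestP => e eF; apply/negP => Fe.
(* If [e] were not a bridge, [F :\ e] would have one edge fewer and the same components, too few to
   account for all vertices. *)
have := card_vertices_le (F :\ e); rewrite -(comps_addN Fe) setD1K //.
by have := cardsD1 e F; rewrite eF; lia.
Qed.

End Graph.

Theorem theorem3p4 (G : mgraph) (L : {set {set edge G}})
    (hL : linear_class L) (hnt : ~ trivial_class L)
    (J0 : matroid (option (edge G))) (hJ0 : is_J0 L J0)
    (F : {set edge G}) :
  basis (contract_None J0) F <->
  [/\ forest F, bond (ext (comps F)) & ext (comps F) \notin L].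
Proof.
have [bondL _] := hL; rewrite /contract_None basis_dual.
by split=> [|[]]; [apply: basis_Jdual | apply: basis_forest].
Qed.
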